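(* For every integer $b>4$, $$R_{(b,4)}<\left(\frac{1}{\log b}+\frac{b^2}{(b^2-3b+2)\log(b-2)}\right)^{-1}.$$
   Context: All logarithms are to base 2. For integers $b\ge k$ and $n\ge1$, a $(b,k)$-hash code of length $n$ is a subset $C\subseteq\{1,\dots,b\}^n$ such that for any $k$ distinct elements of $C$ there is a coordinate in which they are pairwise distinct; $A(b,k,n)$ is the largest size of such a code and $R_{(b,k)}=\limsup_{n\to\infty}\frac1n\log A(b,k,n)$. *)

(* Defs.v *)
From HB Require Import structures.
From mathcomp Require Import all_boot all_order all_algebra.
From mathcomp Require Import all_classical all_reals all_analysis.
Set Implicit Arguments. Unset Strict Implicit. Unset Printing Implicit Defensive.
Import Order.TTheory GRing.Theory Num.Theory.
Local Open Scope ring_scope.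

Definition word (b n : nat) := {ffun 'I_n -> 'I_b}.

Definition is_hash_code (b k n : nat) (C : {set word b n}) : Prop :=
  forall S : {set word b n}, S \subset C -> #|S| = k ->
    exists i : 'I_n, {in S &, injective (fun x : word b n => x i)}.

Definition hashA (b k n : nat) : nat :=
  \max_(C : {set word b n} | `[< is_hash_code k C >]) #|C|.

Definition log2 {R : realType} (x : R) : R := ln x / ln 2.

Definition hash_rate {R : realType} (b k : nat) : \bar R :=
  limn_esup (fun n : nat => ((n%:R)^-1 * log2 ((hashA b k n)%:R : R))%:E).

(* Main.v *)
(** Call a coordinate rainbow for a triple of words if they are pairwise
    distinct there.  For distinct [x, y] in a code [C] of size [M], a Hansel-type
    argument shows that [ln (M - 2)] is at most [ln (b - 2)] times the average
    over [z] of the number of rainbow coordinates of [x, y, z].  Partition [C]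
    into classes according to the first [l] coordinates, with [b ^ l] slightly
    below [M], and average over pairs [x, y] of the same class: a coordinate of
    the prefix contributes nothing, any other one at most
    [k = (b - 1)(b - 2) / b ^ 2]
    by convexity.  This gives the bound with [<=].

    For the strict inequality the prefix is first quantised: in each block of
    [2 ^ r] coordinates a Hamming-type code of density at most [2 ^ -r] with
    covering radius 1 replaces the exact value of the block.  Words of the same
    class now differ in at most two coordinates of a block, but there are
    [2 ^ r] times fewer classes per block, so more blocks fit in the prefix; for
    [r] large this is a net gain in the exponent. *)

Require Import Defs.
From HB Require Import structures.
From mathcomp Require Import all_boot all_order all_algebra.
From mathcomp Require Import all_classical all_reals all_analysis.
From mathcomp Require Import ring lra zify.
Import Order.TTheory GRing.Theory Num.Theory.
Local Open Scope ring_scope.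

(** * Rainbow coordinates and the Hansel-type bound for a pair of words *)

Definition rainbow {b n : nat} (x y z : word b n) (i : 'I_n) : bool :=
  [&& x i != y i, x i != z i & y i != z i].

(* Pick at each coordinate a random symbol outside [{x i, y i}] and discard the
   words [z] that are rainbow there with another symbol: the hash property lets
   at most one word survive, so the survival probabilities sum to at most 1. *)
Lemma hash_code_survival_sum (R : realFieldType) (b n : nat)
    (C : {set word b n}) (x y : word b n) :
  (2 < b)%N -> is_hash_code 4 C -> x \in C -> y \in C -> x != y ->
  \sum_(z in C :\ x :\ y)
    ((b - 2)%:R^-1 : R) ^+ #|[set i | rainbow x y z i]| <= 1.
Proof.
move=> b2 hC xC yC xy.
(* The law of the random symbol [f i]. Where [x] and [y] agree no [z] is rainbow, and the law is the
   point mass at [x i]. *)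
pose w (i : 'I_n) (a : 'I_b) : R :=
  if x i == y i then (a == x i)%:R
  else ((a != x i) && (a != y i))%:R / (b - 2)%:R.
pose ok (z f : word b n) := [forall i, rainbow x y z i ==> (f i == z i)].
have b2R : (b - 2)%:R != 0 :> R by rewrite pnatr_eq0; lia.
have w0 i a : 0 <= w i a.
  by rewrite /w; case: ifP => _; [exact: ler0n | rewrite divr_ge0].
have w1 i : \sum_a w i a = 1.
  rewrite /w; case: eqP => [e|/eqP e].
    by rewrite (bigD1 (x i)) //= eqxx big1 ?addr0 // => a /negbTE ->.
  rewrite -mulr_suml -natr_sum.
  suff -> : (\sum_a ((a != x i) && (a != y i)) = b - 2)%N by rewrite divff.
  have -> : (\sum_a ((a != x i) && (a != y i)) = #|~: [set x i; y i]|)%N.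
    rewrite -sum1_card [RHS]big_mkcond /=; apply: eq_bigr => a _.
    by rewrite !inE negb_or; case: (_ && _).
  by rewrite cardsCs finset.setCK cards2 e card_ord.
have W1 : \sum_(f : word b n) \prod_i w i (f i) = 1.
  by rewrite -bigA_distr_bigA big1.
(* By independence the survival probability is a product over the coordinates, with a factor
   [1 / (b - 2)] at each rainbow one and 1 elsewhere. *)
have okE z : ((b - 2)%:R^-1 : R) ^+ #|[set i | rainbow x y z i]| =
    \sum_(f : word b n) (\prod_i w i (f i)) * (ok z f)%:R.
  transitivity (\prod_i \sum_a w i a * (rainbow x y z i ==> (a == z i))%:R).
    rewrite -prodr_const big_mkcond /=; apply: eq_bigr => i _.
    rewrite inE; case: ifP => [Hr|Hr]; last first.
      by rewrite -[LHS](w1 i); apply: eq_bigr => a _; rewrite mulr1.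
    rewrite (bigD1 (z i)) //= eqxx mulr1 big1 ?addr0; last first.
      by move=> a /negbTE ->; rewrite mulr0.
    move: Hr => /and3P[/negbTE h1 h2 h3].
    by rewrite /w h1 eq_sym h2 eq_sym h3 mul1r.
  rewrite bigA_distr_bigA; apply: eq_bigr => f _.
  rewrite big_split /=; congr (_ * _).
  rewrite /ok; case: forallP => [H|H].
    by rewrite big1 // => i _; rewrite H.
  have /existsP[i Hi] : [exists i, ~~ (rainbow x y z i ==> (f i == z i))].
    by rewrite -negb_forall; apply/forallP.
  by rewrite (bigD1 i) //= (negbTE Hi) mul0r.
under eq_bigr do rewrite okE.
rewrite exchange_big /= -[X in _ <= X]W1.
apply: ler_sum => f _; rewrite -mulr_sumr.
rewrite ler_piMr ?prodr_ge0 //.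
rewrite -natr_sum lern1.
have -> : (\sum_(z in C :\ x :\ y) ok z f =
           #|[set z in C :\ x :\ y | ok z f]|)%N.
  rewrite -sum1_card big_mkcond [RHS]big_mkcond /=.
  by apply: eq_bigr => z _; rewrite !inE; case: (ok z f); case: (_ && _).
apply/card_le1_eqP => z1 z2; rewrite !inE.
move=> /andP[/and3P[z1y z1x z1C] ok1] /andP[/and3P[z2y z2x z2C] ok2].
apply/eqP; apply/negPn/negP => z12.
(* A coordinate separating [x], [y] and two survivors is rainbow for both, so both carry the symbol
   [f i] there: a contradiction. *)
have [|| i inj_i] := hC [set x; y; z1; z2].
- by apply/fintype.subsetP => u; rewrite !inE => /orP[/orP[/orP[]|]|] /eqP ->.
- rewrite finset.setUC cardsU1 !inE !negb_or z2x z2y z12 /=.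
  rewrite finset.setUC cardsU1 !inE !negb_or z1x z1y /= cards2 xy //.
have ne u v : u \in [set x; y; z1; z2] -> v \in [set x; y; z1; z2] ->
    u != v -> u i != v i.
  by move=> hu hv; apply: contra => /eqP /(inj_i _ _ hu hv) ->.
have r1 : rainbow x y z1 i.
  by rewrite /rainbow !ne ?inE ?eqxx ?orbT // eq_sym.
have r2 : rainbow x y z2 i.
  by rewrite /rainbow !ne ?inE ?eqxx ?orbT // eq_sym.
move: ok1 => /forallP /(_ i); rewrite r1 /= => /eqP e1.
move: ok2 => /forallP /(_ i); rewrite r2 /= => /eqP e2.
have := ne z2 z1; rewrite !inE !eqxx !orbT => /(_ isT isT z12).
by rewrite -e1 -e2 eqxx.
Qed.

(** Jensen's inequality for the exponential: with [K = #|A|], sum the tangent bound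
    [1 + s <= expR s] over the values [s = ln K - d z * ln q]. *)
Lemma card_ln_le_sum_exponent (R : realType) (T : finType) (A : {set T})
    (q : R) (d : T -> nat) :
  0 < q -> (0 < #|A|)%N -> \sum_(z in A) q^-1 ^+ d z <= 1 ->
  #|A|%:R * ln (#|A|%:R : R) <= ln q * (\sum_(z in A) d z)%:R.
Proof.
move=> q0 A0 H; set K : R := #|A|%:R.
have K0 : 0 < K by rewrite ltr0n.
have : \sum_(z in A) (1 + (ln K - (d z)%:R * ln q)) <=
       \sum_(z in A) K * q^-1 ^+ d z.
  apply: ler_sum => z _; apply: le_trans (expR_ge1Dx _) _.
  rewrite expRD lnK ?posrE // expRN expRM_natl lnK ?posrE //.
  by rewrite exprVn.
rewrite -mulr_sumr => /le_trans /(_ (ler_wpM2l (ltW K0) H)).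
rewrite big_split /= sumr_const -/K big_split /= sumr_const.
rewrite sumrN -mulr_suml -natr_sum -[ln K *+ _]mulr_natl mulr1.
by rewrite -/K; lra.
Qed.

(** * Convexity at a single coordinate *)

(* The left-hand side is the tangent line at [u] of [g t = 3 t ^ 2 - 2 t ^ 3],
   and [g f] is the minimum over [e] of the right-hand side if [f <= 1 / 2]. *)
Lemma pair_deficit_tangent (R : realFieldType) (u f e : R) :
  0 <= u -> u <= 1 / 5 -> 0 <= f -> f ^+ 2 <= e -> e <= f ->
  3 * u ^+ 2 - 2 * u ^+ 3 + 6 * u * (1 - u) * (f - u) <=
  2 * f ^+ 2 + (1 - 2 * f) * e.
Proof.
move=> u0 u5 f0 fe ef; have [f2|f2] := lerP f (1 / 2).
  have : 0 <= (1 - 2 * f) * (e - f ^+ 2) by apply: mulr_ge0; lra.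
  have : 0 <= (f - u) ^+ 2 * (3 - 2 * f - 4 * u).
    by apply: mulr_ge0; [exact: sqr_ge0 | lra].
  by lra.
(* For [f > 1 / 2] the factor [1 - 2 f] is negative, so the worst case is [e = f], where the
   right-hand side equals [f]. The tangent line stays below because [1 - 6 u + 6 u ^ 2 >= 0], true
   at [u = 1 / 5] but false at [u = 1 / 4]; as [u] will be [1 / b], this step asks for [b > 4]. *)
have : 0 <= (2 * f - 1) * (f - e) by apply: mulr_ge0; lra.
have : 0 <= f * (1 - 6 * u + 6 * u ^+ 2) by apply: mulr_ge0; nra.
have : 0 <= u ^+ 2 * (3 - 4 * u) by apply: mulr_ge0; [exact: sqr_ge0 | lra].
by lra.
Qed.

Lemma sum_off_diagonal (R : comPzRingType) (T : finType) (p F : T -> R)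
    (M : R) :
  \sum_a \sum_(a' | a != a') p a * p a' * (M - F a - F a') =
  M * (\sum_a p a) ^+ 2 - 2 * (\sum_a p a) * (\sum_a p a * F a) -
    \sum_a (M - 2 * F a) * p a ^+ 2.
Proof.
transitivity (\sum_a ((M * (p a * \sum_a' p a') - p a * F a * \sum_a' p a' -
    p a * \sum_a' p a' * F a') - (M - 2 * F a) * p a ^+ 2)).
  apply: eq_bigr => a _.
  have -> : \sum_(a' | a != a') p a * p a' * (M - F a - F a') =
     \sum_a' p a * p a' * (M - F a - F a') - (M - 2 * F a) * p a ^+ 2.
    rewrite [X in _ = X - _](bigD1 a) //=.
    under eq_bigl do rewrite eq_sym.
    by ring.
  congr (_ - _); rewrite !mulr_sumr -!sumrB.
  by apply: eq_bigr => a' _; ring.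
rewrite !sumrB -!mulr_sumr -!mulr_suml.
by ring.
Qed.

Lemma sum_affine_uniform_mean (R : fieldType) (b : nat) (k l : R)
    (p : 'I_b -> R) : b%:R != 0 :> R -> \sum_a p a = 1 ->
  \sum_a (k + l * (p a - b%:R^-1)) = b%:R * k.
Proof.
move=> b0 p1; rewrite big_split /= sumr_const card_ord -mulr_sumr sumrB p1.
rewrite sumr_const card_ord -(mulr_natl _^-1) divff // subrr mulr0 addr0.
by rewrite mulr_natl.
Qed.

Section OneCoordinate.
(** [m w a] stands for the number of codewords of class [w] with symbol [a] at the coordinate. Thus
    [c] gives class sizes, [F] symbol counts, and [M] is the size of the code. *)
Variables (R : realFieldType) (b : nat) (W : finType) (m : W -> 'I_b -> R).
Let c w := \sum_a m w a.
Let F a := \sum_w m w a.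
Let M := \sum_a F a.

(** The lower bound is Cauchy-Schwarz, the upper one is [m w a <= c w]. Empty classes contribute 0
    on both sides, since [0^-1 = 0]. *)
Lemma mean_square_bounds (a : 'I_b) : (forall w a', 0 <= m w a') -> 0 < M ->
  F a ^+ 2 / M <= \sum_w m w a ^+ 2 / c w <= F a.
Proof.
move=> m0 M0.
have mc w : m w a <= c w.
  by rewrite /c (bigD1 a) //= lerDl sumr_ge0.
have cM : \sum_w c w = M by rewrite exchange_big.
apply/andP; split.
  have -> : F a ^+ 2 / M =
      \sum_w (2 * (F a / M) * m w a - (F a / M) ^+ 2 * c w).
    rewrite sumrB -!mulr_sumr -/(F a) cM.
    by field; apply: lt0r_neq0.
  apply: ler_sum => w _; have [c0|c0] := eqVneq (c w) 0.
    have := mc w; rewrite c0 => h; have := m0 w a => h'.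
    have -> : m w a = 0 by apply/eqP; rewrite eq_le h h'.
    by rewrite !(mulr0, expr0n, mul0r, subr0).
  rewrite -subr_ge0.
  have -> : m w a ^+ 2 / c w - (2 * (F a / M) * m w a - (F a / M) ^+ 2 * c w)
      = (m w a - F a / M * c w) ^+ 2 / c w.
    by field; rewrite c0 /= lt0r_neq0.
  by rewrite divr_ge0 ?sqr_ge0 // sumr_ge0.
apply: ler_sum => w _; have [c0|c0] := eqVneq (c w) 0.
  by rewrite c0 invr0 mulr0.
have cp : 0 < c w by rewrite lt0r c0 sumr_ge0.
by rewrite ler_pdivrMr // expr2 ler_wpM2l.
Qed.

(** The frequencies [F a / M] sum to 1, so the tangent at the uniform value [1 / b] loses its linear
    term on summation. What remains, [3 / b - 2 / b ^ 2], is one minus the constant on the right. *)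
Lemma rainbow_mass_le : (4 < b)%N -> (forall w a, 0 <= m w a) -> 0 < M ->
  \sum_w (c w)^-1 * (\sum_a \sum_(a' | a != a') m w a * m w a' *
     (M - F a - F a')) <=
  (b%:R ^+ 2 - 3 * b%:R + 2) / b%:R ^+ 2 * M ^+ 2.
Proof.
move=> b4 m0 M0.
pose E a := \sum_w m w a ^+ 2 / c w.
have bR : 5 <= b%:R :> R by rewrite ler_nat.
have inner w : (c w)^-1 * (\sum_a \sum_(a' | a != a') m w a * m w a' *
     (M - F a - F a')) =
   M * c w - 2 * (\sum_a m w a * F a) -
     \sum_a (M - 2 * F a) * (m w a ^+ 2 / c w).
  rewrite sum_off_diagonal -/(c w).
  have [c0|c0] := eqVneq (c w) 0.
    have mw a : m w a = 0.
      apply/eqP; rewrite eq_le m0 andbT -c0 /c (bigD1 a) //= lerDl.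
      exact: sumr_ge0.
    have -> : \sum_a m w a * F a = 0 by apply: big1 => a _; rewrite mw mul0r.
    have -> : \sum_a (M - 2 * F a) * (m w a ^+ 2 / c w) = 0.
      by apply: big1 => a _; rewrite c0 invr0 !mulr0.
    by rewrite c0 invr0; ring.
  under [X in _ = _ - X]eq_bigr do rewrite mulrA.
  by rewrite -mulr_suml; field.
have cM : \sum_w c w = M by rewrite exchange_big.
have -> : \sum_w (c w)^-1 * (\sum_a \sum_(a' | a != a') m w a * m w a' *
     (M - F a - F a')) =
   M ^+ 2 * (1 - \sum_a (2 * (F a / M) ^+ 2 +
     (1 - 2 * (F a / M)) * (E a / M))).
  under eq_bigr do rewrite inner.
  rewrite !sumrB -!mulr_sumr cM exchange_big /= [X in _ - X]exchange_big /=.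
  have -> : \sum_a \sum_w m w a * F a = \sum_a F a ^+ 2.
    by apply: eq_bigr => a _; rewrite -mulr_suml expr2.
  have -> : \sum_a \sum_w (M - 2 * F a) * (m w a ^+ 2 / c w) =
      \sum_a (M - 2 * F a) * E a.
    by apply: eq_bigr => a _; rewrite -mulr_sumr.
  move: F E M M0 {cM inner} => F' E' M' M0.
  rewrite mulrBr mulr1 expr2 -addrA -opprD; congr (_ - _).
  rewrite !mulr_sumr -big_split /=; apply: eq_bigr => a _.
  by field; apply: lt0r_neq0.
rewrite mulrC ler_wpM2r ?sqr_ge0 //.
have u0 : 0 <= b%:R^-1 :> R by rewrite invr_ge0.
have b0 : 0 < b%:R :> R by rewrite (lt_le_trans _ bR).
have bN0 := lt0r_neq0 b0.
have u5 : b%:R^-1 <= 1 / 5 :> R by rewrite mul1r lef_pV2 ?posrE.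
have : \sum_(a < b) (3 * b%:R^-1 ^+ 2 - 2 * b%:R^-1 ^+ 3 +
         6 * b%:R^-1 * (1 - b%:R^-1) * (F a / M - b%:R^-1)) <=
       \sum_a (2 * (F a / M) ^+ 2 + (1 - 2 * (F a / M)) * (E a / M)).
  apply: ler_sum => a _; have /andP[h1 h2] := mean_square_bounds a m0 M0.
  apply: pair_deficit_tangent => //.
  - by apply: divr_ge0; [exact: sumr_ge0 | exact: ltW].
  - rewrite ler_pdivlMr //; apply: le_trans h1.
    by rewrite le_eqVlt; apply/orP; left; apply/eqP; field; apply: lt0r_neq0.
  - by rewrite ler_wpM2r // invr_ge0 ltW.
have f1 : \sum_a F a / M = 1.
  by rewrite -mulr_suml; exact: (divff (lt0r_neq0 M0)).
rewrite (sum_affine_uniform_mean _ _ _ _ _ bN0 f1).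
have -> : (b%:R ^+ 2 - 3 * b%:R + 2) / b%:R ^+ 2 =
  1 - b%:R * (3 * b%:R^-1 ^+ 2 - 2 * b%:R^-1 ^+ 3) :> R.
  by field.
by rewrite lerD2l lerN2.
Qed.
End OneCoordinate.

(** * Quantising the prefix *)

(* A Hamming-type syndrome in a group of exponent 2 indexing the coordinates:
   changing the parity of the symbol at [d] adds [d] to the syndrome, so one
   change reaches any prescribed class, in particular the smallest one. *)
Lemma one_change_quantizer (G : finZmodType) (b : nat) :
  (1 < b)%N -> (forall g : G, g + g = 0) ->
  exists (S : {set {ffun G -> 'I_b}})
         (q : {ffun G -> 'I_b} -> {ffun G -> 'I_b}),
    (#|S| * #|G| <= b ^ #|G|)%N /\
    forall x, q x \in S /\ (#|[set g | q x g != x g]| <= 1)%N.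
Proof.
move=> b1 gg.
pose syn (x : {ffun G -> 'I_b}) := \sum_g if odd (x g) then g else 0.
pose cl s := [set x | syn x == s].
pose s0 := [arg min_(s < (0 : G)) #|cl s|].
have b0 : (0 < b)%N by lia.
pose fl (a : 'I_b) : 'I_b := if odd a then Ordinal b0 else Ordinal b1.
have oddfl a : odd (fl a) = ~~ odd a by rewrite /fl; case: ifP.
pose flip (d : G) (x : {ffun G -> 'I_b}) : {ffun G -> 'I_b} :=
  [ffun g => if g == d then fl (x g) else x g].
have synflip d x : syn (flip d x) = syn x + d.
  rewrite /syn (bigD1 d) //= [in RHS](bigD1 d) //= ffunE eqxx oddfl.
  under eq_bigr => g gd do rewrite ffunE (negbTE gd).
  case: (odd _) => /=; last by rewrite add0r addrC.
  by rewrite add0r addrAC gg add0r.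
(* If [syn x] is already [s0], the symbol at index 0 is changed, which leaves the syndrome as it
   is. *)
exists (cl s0), (fun x => flip (s0 - syn x) x); split.
  have -> : (b ^ #|G| = \sum_s #|cl s|)%N.
    rewrite -[in LHS](card_ord b) -card_ffun -sum1_card.
    rewrite (partition_big syn predT) //=.
    apply: eq_bigr => s _; rewrite -sum1_card.
    by apply: eq_bigl => x; rewrite !inE.
  rewrite mulnC -sum_nat_const; apply: leq_sum => s _.
  by rewrite /s0; case: arg_minnP => // i _; apply.
move=> x; rewrite inE synflip addrC subrK eqxx; split=> //.
rewrite -(cards1 (s0 - syn x)); apply/subset_leq_card/fintype.subsetP => g.
by rewrite !inE ffunE; case: ifP => // _; rewrite eqxx.
Qed.

(** The first [t * #|G|] coordinates are cut into [t] blocks indexed by [G], each quantised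
    separately; [J] is their union. Hence there are at most [#|S| ^ t] classes. *)
Lemma prefix_quantizer (G : finZmodType) (b n t : nat) :
  (1 < b)%N -> (forall g : G, g + g = 0) -> (t * #|G| <= n)%N ->
  exists (W : finType) (pi : word b n -> W) (J : {set 'I_n}),
    [/\ #|J| = (t * #|G|)%N,
        forall C : {set word b n},
          (#|[set pi x | x in C]| * #|G| ^ t <= (b ^ #|G|) ^ t)%N &
        forall x y, pi x = pi y ->
          (#|[set i in J | x i != y i]| <= 2 * t)%N].
Proof.
move=> b1 gg tn; have [S [q [cS qS]]] := one_change_quantizer G b b1 gg.
have le_n : (#|{: 'I_t * G}| <= n)%N by rewrite card_prod card_ord.
pose e (p : 'I_t * G) : 'I_n := widen_ord le_n (enum_rank p).
have e_inj : injective e.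
  move=> p1 p2 /(congr1 val) /= h; apply: enum_rank_inj; exact: val_inj.
pose block (x : word b n) (j : 'I_t) : {ffun G -> 'I_b} :=
  [ffun g => x (e (j, g))].
exists {ffun 'I_t -> {ffun G -> 'I_b}},
  (fun x => [ffun j => q (block x j)]), [set e p | p in [set: 'I_t * G]].
split.
- by rewrite card_imset // cardsT card_prod card_ord.
- move=> C; apply: (@leq_trans ((#|S| * #|G|) ^ t)); last first.
    by case: (t) => // t'; rewrite leq_exp2r.
  rewrite expnMn leq_mul2r; apply/orP; right.
  rewrite -[X in (_ <= _ ^ X)%N](card_ord t) -card_ffun_on.
  apply/subset_leq_card/fintype.subsetP => f /imsetP[x _ ->].
  by apply/ffun_onP => j; rewrite ffunE; case: (qS (block x j)).
move=> x y xy.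
have -> : [set i in [set e p | p in [set: 'I_t * G]] | x i != y i] =
    [set e p | p in [set p | x (e p) != y (e p)]].
  apply/setP => i; rewrite !inE; apply/andP/imsetP.
    by move=> [/imsetP[p _ ->] h]; exists p; rewrite ?inE.
  by move=> [p]; rewrite inE => h ->; split=> //; apply: imset_f.
rewrite card_imset //.
have -> : #|[set p | x (e p) != y (e p)]| =
    (\sum_j \sum_g (x (e (j, g)) != y (e (j, g))))%N.
  rewrite pair_bigA -sum1_card big_mkcond /=.
  by apply: eq_bigr => -[j g] _; rewrite inE; case: (_ == _).
rewrite mulnC -[X in (_ <= X * _)%N](card_ord t) -sum_nat_const.
apply: leq_sum => j _.
have [_ hx] := qS (block x j); have [_ hy] := qS (block y j).
have qxy : q (block x j) = q (block y j).
  by move/ffunP: xy => /(_ j); rewrite !ffunE.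
have -> : (\sum_g (x (e (j, g)) != y (e (j, g))) =
    #|[set g | x (e (j, g)) != y (e (j, g))]|)%N.
  rewrite -sum1_card [RHS]big_mkcond /=.
  by apply: eq_bigr => g _; rewrite inE; case: (_ == _).
(* Triangle inequality: both blocks are within one change of their common quantised value. *)
apply: leq_trans (leq_add hx hy); apply: leq_trans (leq_card_setU _ _).
apply/subset_leq_card/fintype.subsetP => g; rewrite !inE qxy.
rewrite !ffunE; apply: contraR; rewrite negb_or !negbK.
by move=> /andP[/eqP <- /eqP <-].
Qed.

(** * Averaging over pairs of words in the same class *)

Lemma sum_by_symbol (R : pzRingType) (b n : nat) (A : {set word b n})
    (i : 'I_n) (Phi : 'I_b -> R) :
  \sum_(x in A) Phi (x i) = \sum_a #|[set x in A | x i == a]|%:R * Phi a.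
Proof.
rewrite (partition_big (fun x : word b n => x i) predT) //=.
apply: eq_bigr => a _; rewrite mulr_natl -sumr_const.
by apply: eq_big => x; rewrite ?inE // => /andP[_ /eqP ->].
Qed.

Lemma rainbow_coordinate_sum (R : realFieldType) (b n : nat)
    (C : {set word b n}) (W : finType) (pi : word b n -> W) (i : 'I_n) :
  (4 < b)%N -> (0 < #|C|)%N ->
  \sum_w #|[set x in C | pi x == w]|%:R^-1 *
    (\sum_(x in [set x in C | pi x == w])
     \sum_(y in [set x in C | pi x == w]) \sum_(z in C) (rainbow x y z i)%:R)
  <= (b%:R ^+ 2 - 3 * b%:R + 2) / b%:R ^+ 2 * #|C|%:R ^+ 2 :> R.
Proof.
move=> b4 C0.
pose cl w := [set x in C | pi x == w].
pose m w a : R := #|[set x in cl w | x i == a]|%:R.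
have cE w : #|cl w|%:R = \sum_a m w a.
  rewrite -sum1_card natr_sum (sum_by_symbol _ _ _ (cl w) i (fun=> 1)).
  by under eq_bigr do rewrite mulr1.
have FE a : \sum_w m w a = #|[set x in C | x i == a]|%:R.
  rewrite -natr_sum -sum1_card (partition_big pi predT) //=.
  congr (_%:R); apply: eq_bigr => w _; rewrite sum1dep_card.
  by apply: eq_card => x; rewrite !inE andbAC.
have ME : \sum_a \sum_w m w a = #|C|%:R.
  under eq_bigr do rewrite FE.
  rewrite -sum1_card natr_sum (sum_by_symbol _ _ _ C i (fun=> 1)).
  by under [in RHS]eq_bigr do rewrite mulr1.
have M0 : 0 < \sum_a \sum_w m w a by rewrite ME ltr0n.
have := rainbow_mass_le R b W m b4 (fun w a => ler0n _ _) M0.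
rewrite ME; apply: le_trans; rewrite le_eqVlt; apply/orP; left; apply/eqP.
apply: eq_bigr => w _; rewrite -cE; congr (_ * _).
rewrite -/(cl w).
(* Once [x i != y i], the words [z] rainbow with them are those avoiding two distinct symbols, and
   inclusion-exclusion has no overlap term. *)
transitivity (\sum_(x in cl w) \sum_(y in cl w)
   (x i != y i)%:R * (#|C|%:R - \sum_w m w (x i) - \sum_w m w (y i)) : R).
  apply: eq_bigr => x _; apply: eq_bigr => y _.
  case: (boolP (x i == y i)) => xy; rewrite ?mul0r ?mul1r.
    by rewrite big1 // => z _; rewrite /rainbow xy.
  rewrite !FE -3!sum1_card !natr_sum.
  rewrite [X in _ = _ - X - _]big_mkcond [X in _ = _ - _ - X]big_mkcond /=.
  rewrite [X in _ = X - _ - _]big_mkcond [LHS]big_mkcond /= -!sumrB.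
  apply: eq_bigr => z _; rewrite !inE /rainbow xy /=.
  case: (z \in C) => /=; last by rewrite !subr0.
  rewrite [x i == z i]eq_sym [y i == z i]eq_sym.
  case: eqP => [zx|_] /=; last by case: eqP => _ /=; rewrite ?subr0 ?subrr.
  by rewrite zx (negbTE xy) subrr subr0.
rewrite (sum_by_symbol _ _ _ (cl w) i (fun a => \sum_(y in cl w)
   (a != y i)%:R * (#|C|%:R - \sum_w m w a - \sum_w m w (y i)) : R)).
apply: eq_bigr => a _.
rewrite (sum_by_symbol _ _ _ (cl w) i (fun a' =>
   (a != a')%:R * (#|C|%:R - \sum_w m w a - \sum_w m w a') : R)).
rewrite mulr_sumr [RHS]big_mkcond /=; apply: eq_bigr => a' _.
by case: (a != a'); rewrite ?mul0r ?mulr0 // mul1r mulrA.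
Qed.

(** Double counting of rainbow coordinates over triples whose first two words share a class, each
    class weighted by the inverse of its size. With this weight the ordered pairs of distinct words
    in a class of size [c] count [c - 1], so in total [#|C|] minus the number of classes. *)
Lemma hash_code_class_bound (R : realType) (b n D : nat)
    (C : {set word b n}) (W : finType) (pi : word b n -> W)
    (J : {set 'I_n}) :
  (4 < b)%N -> is_hash_code 4 C -> (2 < #|C|)%N ->
  (forall x y, pi x = pi y -> (#|[set i in J | x i != y i]| <= D)%N) ->
  (#|C|%:R - #|[set pi x | x in C]|%:R) *
    ((#|C|%:R - 2) * ln (#|C|%:R - 2)) <=
  ln ((b - 2)%:R : R) * (#|C|%:R ^+ 2 *
    (D%:R + (n%:R - #|J|%:R) *
      ((b%:R ^+ 2 - 3 * b%:R + 2) / b%:R ^+ 2))).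
Proof.
move=> b4 hC C2 HJ.
set Y := (#|C|%:R - 2) * ln (#|C|%:R - 2).
set L := ln _; set kap := (_ / _).
pose cl w := [set x in C | pi x == w].
pose rb (x y z : word b n) : R := #|[set i | rainbow x y z i]|%:R.
have L0 : 0 <= L by apply: ln_ge0; rewrite ler1n; lia.
have rb0 x y z : 0 <= rb x y z by exact: ler0n.
have Y0 : 0 <= Y.
  have : (3 <= #|C|%:R :> R) by rewrite ler_nat.
  by move=> h; apply: mulr_ge0; [|apply: ln_ge0]; lra.
have pairY x y : x \in C -> y \in C -> x != y ->
    Y <= L * \sum_(z in C) rb x y z.
  move=> xC yC xy.
  have cA : #|C :\ x :\ y| = (#|C| - 2)%N.
    have := cardsD1 x C; have := cardsD1 y (C :\ x).
    by rewrite xC !inE yC eq_sym xy /=; lia.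
  have A0 : (0 < #|C :\ x :\ y|)%N by rewrite cA; lia.
  have q0 : 0 < (b - 2)%:R :> R by rewrite ltr0n; lia.
  have b2 : (2 < b)%N by lia.
  have := card_ln_le_sum_exponent R _ _ _ _ q0 A0
            (hash_code_survival_sum R b n C x y b2 hC xC yC xy).
  rewrite cA natrB 1?ltnW // => /le_trans; apply.
  rewrite ler_wpM2l // natr_sum.
  rewrite big_mkcond [X in _ <= X]big_mkcond /=; apply: ler_sum => z _.
  rewrite !inE; case: (z \in C); rewrite ?andbF //= andbT.
  by case: ifP => _; rewrite ?rb0.
pose X := \sum_w #|cl w|%:R^-1 * (\sum_(x in cl w) \sum_(y in cl w)
  \sum_(z in C) rb x y z).
have lower : (#|C|%:R - #|[set pi x | x in C]|%:R) * Y <= L * X.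
  have -> : #|C|%:R - #|[set pi x | x in C]|%:R =
     \sum_w (#|cl w|%:R - (w \in [set pi x | x in C])%:R) :> R.
    rewrite sumrB -!natr_sum; congr (_%:R - _%:R).
      rewrite -sum1_card (partition_big pi predT) //=.
      apply: eq_bigr => w _; rewrite sum1dep_card.
      by apply: eq_card => x; rewrite !inE.
    rewrite -sum1_card big_mkcond /=.
    by apply: eq_bigr => w _; case: (_ \in _).
  rewrite /X mulr_suml mulr_sumr; apply: ler_sum => w _.
  case: (boolP (w \in _)) => [/imsetP[x0 x0C wE]|wN]; last first.
    have -> : cl w = finset.set0.
      apply/setP => x; rewrite !inE; apply/negbTE; apply: contra wN.
      by move=> /andP[xC /eqP <-]; apply: imset_f.
    by rewrite cards0 subrr mul0r invr0 mul0r mulr0.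
  have c0 : 0 < #|cl w|%:R :> R.
    by rewrite ltr0n card_gt0; apply/set0Pn; exists x0; rewrite !inE x0C wE /=.
  rewrite [X in _ <= X]mulrCA ler_pdivlMl //.
  have -> : #|cl w|%:R * ((#|cl w|%:R - 1) * Y) =
      \sum_(x in cl w) ((#|cl w|%:R - 1) * Y).
    by rewrite sumr_const mulr_natl.
  rewrite mulr_sumr; apply: ler_sum => x xcl.
  have -> : (#|cl w|%:R - 1) * Y = \sum_(y in cl w :\ x) Y.
    rewrite sumr_const -[RHS]mulr_natl; congr (_ * _).
    by rewrite (cardsD1 x (cl w)) xcl natrD addrAC subrr add0r.
  rewrite mulr_sumr big_mkcond [X in _ <= X]big_mkcond /=.
  apply: ler_sum => y _; move: xcl; rewrite !inE => /andP[xC _].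
  case: (boolP (y == x)) => [_|yx] /=.
    by case: ifP => // _; rewrite mulr_ge0 ?sumr_ge0.
  by case: ifP => // /andP[yC _]; apply: pairY; rewrite // eq_sym.
apply: le_trans lower _; rewrite ler_wpM2l //.
(* Inside [J] a rainbow coordinate is one where [x] and [y] differ, so there are at most [D] of
   them. *)
have split_rb x y z : pi x = pi y ->
    rb x y z <= D%:R + \sum_(i in ~: J) (rainbow x y z i)%:R.
  move=> xy; rewrite /rb -sum1_card natr_sum big_mkcond /=.
  rewrite (bigID (mem J)) /=; apply: lerD.
    apply: le_trans (_ : #|[set i in J | x i != y i]|%:R <= _); last first.
      by rewrite ler_nat HJ.
    rewrite -sum1_card natr_sum big_mkcond [X in _ <= X]big_mkcond /=.
    apply: ler_sum => i _; rewrite !inE /rainbow.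
    by case: (i \in J) => //=; case: (x i == y i) => //=; case: ifP.
  rewrite le_eqVlt; apply/orP; left; apply/eqP.
  by apply: eq_big => i; rewrite ?inE //; case: rainbow.
have c2 : \sum_w #|cl w|%:R^-1 *
    (\sum_(x in cl w) \sum_(y in cl w) \sum_(z in C) D%:R) <=
    #|C|%:R ^+ 2 * D%:R :> R.
  have -> : #|C|%:R ^+ 2 * D%:R = \sum_w #|cl w|%:R * (#|C|%:R * D%:R) :> R.
    rewrite -mulr_suml expr2 -mulrA; congr (_ * _).
    rewrite -natr_sum; congr (_%:R).
    rewrite -sum1_card (partition_big pi predT) //=.
    apply: eq_bigr => w _; rewrite sum1dep_card.
    by apply: eq_card => x; rewrite !inE.
  apply: ler_sum => w _; rewrite !sumr_const.
  have [->|c0] := eqVneq #|cl w| 0%N; first by rewrite invr0 !mul0r.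
  rewrite -(mulr_natl (D%:R *+ _ *+ _)) mulKf ?pnatr_eq0 //.
  by rewrite -(mulr_natl (D%:R *+ _)) -(mulr_natl D%:R).
apply: (@le_trans _ _ (\sum_w #|cl w|%:R^-1 *
    (\sum_(x in cl w) \sum_(y in cl w) \sum_(z in C)
      (D%:R + \sum_(i in ~: J) (rainbow x y z i)%:R)))).
  apply: ler_sum => w _; rewrite ler_wpM2l ?invr_ge0 //.
  apply: ler_sum => x; rewrite inE => /andP[_ /eqP xw].
  apply: ler_sum => y; rewrite inE => /andP[_ /eqP yw].
  by apply: ler_sum => z _; apply: split_rb; rewrite xw yw.
have -> : \sum_w #|cl w|%:R^-1 *
    (\sum_(x in cl w) \sum_(y in cl w) \sum_(z in C)
      (D%:R + \sum_(i in ~: J) (rainbow x y z i)%:R)) =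
  \sum_w #|cl w|%:R^-1 *
    (\sum_(x in cl w) \sum_(y in cl w) \sum_(z in C) D%:R) +
  \sum_(i in ~: J) \sum_w #|cl w|%:R^-1 *
    (\sum_(x in cl w) \sum_(y in cl w) \sum_(z in C) (rainbow x y z i)%:R)
  :> R.
  rewrite [X in _ = _ + X]exchange_big /= -big_split /=; apply: eq_bigr => w _.
  rewrite -mulr_sumr -mulrDr; congr (_ * _).
  rewrite [X in _ = _ + X]exchange_big /= -big_split /=; apply: eq_bigr => x _.
  rewrite [X in _ = _ + X]exchange_big /= -big_split /=; apply: eq_bigr => y _.
  by rewrite [X in _ = _ + X]exchange_big /= -big_split /=.
rewrite mulrDr; apply: lerD => //.
have -> : #|C|%:R ^+ 2 * ((n%:R - #|J|%:R) * kap) =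
    \sum_(i in ~: J) kap * #|C|%:R ^+ 2.
  rewrite sumr_const -[RHS]mulr_natl.
  have -> : #|~: J|%:R = n%:R - #|J|%:R :> R.
    have e : #|J|%:R + #|~: J|%:R = n%:R :> R by rewrite -natrD cardsC card_ord.
    by rewrite -e addrAC subrr add0r.
  by ring.
apply: ler_sum => i _; apply: rainbow_coordinate_sum => //.
exact: leq_trans C2.
Qed.

(** The group indexing a block is the additive group of the vector space of dimension [r] over the
    field with two elements, and [D = 2 * t]. *)
Lemma hash_code_block_bound (R : realType) (b n r t : nat)
    (C : {set word b n}) :
  (4 < b)%N -> is_hash_code 4 C -> (2 < #|C|)%N -> (t * 2 ^ r <= n)%N ->
  (#|C|%:R - ((b ^ 2 ^ r)%:R / (2 ^ r)%:R) ^+ t) *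
    ((#|C|%:R - 2) * ln (#|C|%:R - 2)) <=
  ln ((b - 2)%:R : R) * (#|C|%:R ^+ 2 *
    ((2 * t)%:R + (n%:R - (t * 2 ^ r)%:R) *
      ((b%:R ^+ 2 - 3 * b%:R + 2) / b%:R ^+ 2))).
Proof.
move=> b4 hC C2 tn.
have cG : #|{: 'rV['F_2]_r}| = (2 ^ r)%N by rewrite card_mx card_Fp // mul1n.
have gg (g : 'rV['F_2]_r) : g + g = 0.
  by apply/matrixP => i j; rewrite !mxE addrr_pchar2 // pchar_Fp.
have [|| W [pi [J [cJ cW HJ]]]] := prefix_quantizer 'rV['F_2]_r b n t _ gg.
- by lia.
- by rewrite cG.
have := hash_code_class_bound R b n _ C W pi J b4 hC C2 HJ.
rewrite cJ cG; apply: le_trans; apply: ler_wpM2r.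
  have : (3 <= #|C|%:R :> R) by rewrite ler_nat.
  by move=> h; apply: mulr_ge0; [|apply: ln_ge0]; lra.
rewrite lerD2l lerN2 expr_div_n ler_pdivlMr; last first.
  by rewrite exprn_gt0 // ltr0n expn_gt0.
rewrite -!natrX -natrM ler_nat.
by rewrite -[X in (_ * X ^ _)%N]cG -[X in (_ <= (_ ^ X) ^ _)%N]cG; apply: cW.
Qed.

(** * Choice of constants and the exponential bound *)

(* Enlarging a class of prefixes by a factor [2 ^ r] per block gains
   [r * ln 2] in the exponent, while it costs only two coordinates; the gain
   wins as soon as [k * r * ln 2 > 2 * ln b]. *)
Lemma slack_constants (R : realType) (B L l2 k T : R) :
  0 < l2 -> 2 * l2 <= B -> 0 < L -> 0 < k -> k * L <= B ->
  T * (B + k * L) = k * L * B ->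
  exists (r : nat) (eta delta : R),
    [/\ 0 < (2 ^ r)%:R * B - r%:R * l2,
        T * (2 ^ r)%:R <= (2 ^ r)%:R * B - r%:R * l2 /\ 2 <= (2 ^ r)%:R * k,
        0 < eta /\ 4 * eta <= T, 0 < delta &
        L * k - (T - 2 * eta) / ((2 ^ r)%:R * B - r%:R * l2) *
          (L * ((2 ^ r)%:R * k - 2)) <= T - eta - delta].
Proof.
move=> l20 l2B L0 k0 kLB TE.
have B0 : 0 < B by lra.
have kL0 : 0 < k * L by exact: mulr_gt0.
have T0 : 0 < T.
  have : 0 < T * (B + k * L) by rewrite TE mulr_gt0.
  by rewrite pmulr_lgt0 //; lra.
(* [T] is half the harmonic mean of [B] and [k * L], hence at most half the larger. Together with
   [m * B <= 2 * nu] this makes the prefix fit into the word. *)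
have TB : 2 * T <= B.
  have : 2 * T * (B + k * L) <= B * (B + k * L).
    rewrite -mulrA TE; have : 0 <= B * (B - k * L) by apply: mulr_ge0; lra.
    by lra.
  by rewrite ler_pM2r //; lra.
pose r := Num.bound (2 * B / (k * l2)).
have kl0 : 0 < k * l2 by exact: mulr_gt0.
have rP : 2 * B < k * l2 * r%:R.
  have /archi_boundP : 0 <= 2 * B / (k * l2) by apply: divr_ge0; lra.
  by rewrite ltr_pdivrMr // [X in _ < X]mulrC.
exists r; set m : R := (2 ^ r)%:R; set nu := m * B - _.
have rm : r%:R <= m by rewrite ler_nat ltnW // ltn_expl.
have r0 : 0 <= r%:R :> R by [].
have nuB : m * B <= 2 * nu.
  have : r%:R * (2 * l2) <= m * B by apply: ler_pM; lra.
  by rewrite /nu; lra.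
have m0 : 0 < m by rewrite ltr0n expn_gt0.
have nu0 : 0 < nu by have := mulr_gt0 m0 B0; lra.
have Tm : T * m <= nu.
  have : 2 * T * m <= B * m by rewrite ler_pM2r.
  by lra.
have mk : 2 <= m * k.
  have : k * l2 * r%:R <= k * l2 * m by rewrite ler_pM2l.
  move=> h; have h1 : 2 * (2 * l2) <= k * l2 * m by lra.
  have : 4 * l2 <= (m * k) * l2 by lra.
  by rewrite ler_pM2r //; lra.
pose Q := L * (m * k - 2) / nu.
have Q0 : 0 <= Q by rewrite divr_ge0 ?mulr_ge0 //; lra.
(* The slack at [eta = 0]: blocks of density [T / nu] save [L * (m * k - 2)] each. By the equation
   for [T] its sign is that of [k * l2 * r - 2 * B]. *)
pose h := T - L * k + T * Q.
have h0 : 0 < h.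
  have : 0 < h * (nu * B).
    have -> : h * (nu * B) = T * L * (k * l2 * r%:R - 2 * B).
      have -> : h * (nu * B) = T * B * nu - k * L * B * nu +
           T * (L * (m * k - 2)) * B.
        by rewrite /h /Q; field; exact: lt0r_neq0.
      by rewrite -TE /nu; ring.
    by apply: mulr_gt0; [exact: mulr_gt0 | lra].
  by rewrite pmulr_lgt0 // mulr_gt0.
(* A positive [eta] costs [eta * (1 + 2 * Q)]; the second term of the minimum keeps this below
   [h / 2], and the other half of [h] is [delta]. *)
exists (Num.min (T / 4) (h / (2 * (1 + 2 * Q)))), (h / 2).
set eta := Num.min _ _.
have Q1 : 0 < 2 * (1 + 2 * Q) by lra.
have eta1 : 4 * eta <= T.
  have : eta <= T / 4 by rewrite ge_min lexx.
  by lra.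
have eta2 : eta * (2 * (1 + 2 * Q)) <= h.
  by rewrite -ler_pdivlMr // ge_min lexx orbT.
split=> //.
- by split=> //; rewrite lt_min divr_gt0 //= divr_gt0.
- by rewrite divr_gt0.
have -> : (T - 2 * eta) / nu * (L * (m * k - 2)) = (T - 2 * eta) * Q.
  by rewrite /Q; ring.
by rewrite /h in eta2 *; lra.
Qed.

(** Suppose a code is larger than [expR (rho * n)] with [rho = T - eta]. A prefix with at most
    [expR ((T - 2 * eta) * n)] classes then has exponentially fewer classes than codewords, and the
    block bound forces [delta * n] to stay bounded. *)
Lemma hash_code_exp_bound (R : realType) (b : nat) (T : R) :
  (4 < b)%N ->
  let k := (b%:R ^+ 2 - 3 * b%:R + 2) / b%:R ^+ 2 in
  T * (ln b%:R + k * ln (b - 2)%:R) = k * ln (b - 2)%:R * ln b%:R ->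
  exists (rho : R) (n0 : nat), rho < T /\
    forall n (C : {set word b n}), (n0 <= n)%N -> is_hash_code 4 C ->
      #|C|%:R <= expR (rho * n%:R).
Proof.
move=> b4 k TE.
have le4 (p q u v n : nat) : (p + q + u + v <= n)%N ->
    [/\ (p <= n)%N, (q <= n)%N, (u <= n)%N & (v <= n)%N] by split; lia.
set B := ln b%:R in TE; set L := ln (b - 2)%:R in TE.
pose l2 : R := ln 2.
have bR : 5 <= b%:R :> R by rewrite ler_nat.
have b0 : 0 < b%:R :> R by lra.
have b20 : 0 < b%:R ^+ 2 :> R by rewrite exprn_gt0.
have b2R : (b - 2)%:R = b%:R - 2 :> R by rewrite natrB //; lia.
have l20 : 0 < l2 by rewrite ln_gt0 // ltr1n.
have l2B : 2 * l2 <= B.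
  have -> : 2 * l2 = ln (2 * 2 : R) by rewrite lnM ?posrE // -/l2; ring.
  by rewrite ler_ln ?posrE //; lra.
have L0 : 0 < L by rewrite ln_gt0 // b2R; lra.
have LB : L <= B by rewrite ler_ln ?posrE ?b2R //; lra.
have k0 : 0 < k by rewrite divr_gt0 //; nra.
have k1 : k <= 1 by rewrite ler_pdivrMr //; nra.
have kLB : k * L <= B.
  by apply: le_trans LB; rewrite ler_piMl // ltW.
have [r [eta [delta [nu0 [Tm mk] [eta0 etaT] delta0 Hd]]]] :=
  slack_constants R B L l2 k T l20 l2B L0 k0 kLB TE.
move: nu0 Tm mk Hd; set m : R := (2 ^ r)%:R; set nu := m * B - _.
move=> nu0 Tm mk Hd.
pose rho := T - eta; pose sig := (T - 2 * eta) / nu.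
have rho0 : 0 < rho by rewrite /rho; lra.
have sig0 : 0 <= sig by rewrite divr_ge0 //; lra.
(* The bounded errors: [l2] from replacing [M - 2] by half the lower bound on [M], [3 * (rho / eta)]
   from the factor [1 - 3 * eps], and the last term from rounding the number of blocks down. *)
pose K0 := l2 + 3 * (rho / eta) + L * (m * k - 2).
exists rho, (Num.bound (K0 / delta) + Num.bound (3 / eta) +
             Num.bound (3 / rho) + Num.bound (l2 / rho))%N.
split; first by rewrite /rho; lra.
move=> n C nn0 hC.
have K00 : 0 <= K0.
  have : 0 <= rho / eta by rewrite divr_ge0 ?ltW.
  have : 0 <= L * (m * k - 2) by apply: mulr_ge0; lra.
  by rewrite /K0; lra.
have [bK be br bl] := le4 _ _ _ _ _ nn0.
have bnd (x y : R) : 0 <= x -> 0 < y -> (Num.bound (x / y) <= n)%N ->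
    x < y * n%:R.
  move=> x0 y0 xyn; rewrite mulrC -ltr_pdivrMr //.
  apply: lt_le_trans (archi_boundP _) _; last by rewrite ler_nat.
  by rewrite divr_ge0 // ltW.
have nd : K0 < delta * n%:R by exact: bnd.
have ne : 3 < eta * n%:R by exact: bnd.
have nr : 3 < rho * n%:R by exact: bnd.
have nl : l2 < rho * n%:R by exact: bnd (ltW l20) rho0 bl.
have n0 : 0 <= n%:R :> R by [].
rewrite leNgt; apply/negP => Mbig.
set M : R := #|C|%:R in Mbig.
have M4 : 4 < M.
  by apply: le_lt_trans Mbig; apply: le_trans (expR_ge1Dx _); lra.
have M0 : 0 < M by lra.
have C2 : (2 < #|C|)%N.
  by rewrite -(ltr_nat R) -/M; lra.
pose t := Num.truncn (sig * n%:R).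
have /andP[t1 t2] : t%:R <= sig * n%:R < t.+1%:R.
  by apply: truncn_itv; rewrite mulr_ge0.
have sigm : sig * m <= 1.
  rewrite /sig mulrAC ler_pdivrMr // mul1r.
  have etam : 0 <= eta * m by apply: mulr_ge0 => //; exact: ltW.
  by lra.
have tn : (t * 2 ^ r <= n)%N.
  rewrite -(ler_nat R) natrM -/m.
  apply: (@le_trans _ _ (sig * n%:R * m)).
    by rewrite ler_wpM2r // ltW.
  by rewrite mulrAC ler_piMl.
have := hash_code_block_bound R b n r t C b4 hC C2 tn.
rewrite -/M -/L -/k [(t * _)%:R]natrM -/m.
set N := (_ / _) ^+ t; set Z := (_ + _ * k) => main.
(* A cruder substitute for [expR (- (eta * n))]; it suffices because [eps * n] is bounded. *)
pose eps := (eta * n%:R)^-1.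
have en0 : 0 < eta * n%:R by lra.
have eps0 : 0 < eps by rewrite invr_gt0.
have expeps : expR (- (eta * n%:R)) <= eps.
  rewrite expRN /eps lef_pV2 ?posrE ?expR_gt0 //.
  by apply: le_trans (expR_ge1Dx _); lra.
have NM : N <= M * eps.
  have -> : N = expR (t%:R * nu).
    rewrite expRM_natl /nu expRD expRN !expRM_natl /B /l2 !lnK ?posrE //.
    by rewrite -natrX -natrX.
  apply: (@le_trans _ _ (expR (rho * n%:R) * expR (- (eta * n%:R)))).
    rewrite -expRD ler_expR.
    have -> : rho * n%:R - eta * n%:R = sig * n%:R * nu.
      by rewrite /sig /rho; field; exact: lt0r_neq0.
    by rewrite ler_wpM2r // ltW.
  by apply: ler_pM => //; rewrite ?expR_ge0 // ltW.
have M2 : 2 <= M * (2 * eps).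
  have h1 : 1 <= expR (rho * n%:R) * expR (- (eta * n%:R)).
    rewrite -expRD -[X in X <= _](@expR0 R) ler_expR.
    have : 0 <= (T - 2 * eta) * n%:R by apply: mulr_ge0; lra.
    by rewrite /rho; lra.
  have h2 : expR (rho * n%:R) * expR (- (eta * n%:R)) <= M * eps.
    by apply: ler_pM => //; rewrite ?expR_ge0 // ltW.
  by lra.
have lnM : rho * n%:R - l2 <= ln (M - 2).
  have -> : rho * n%:R - l2 = ln (expR (rho * n%:R) / 2).
    by rewrite ln_div ?posrE ?expR_gt0 // expRK.
  by rewrite ler_ln ?posrE ?divr_gt0 ?expR_gt0 //; lra.
have eps3 : eps * 3 <= 1.
  by rewrite /eps mulrC ler_pdivrMr // mul1r ltW.
have lower : M ^+ 2 * ((1 - 3 * eps) * (rho * n%:R - l2)) <=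
    (M - N) * ((M - 2) * ln (M - 2)).
  rewrite !mulrA; apply: ler_pM => //.
  - by rewrite mulr_ge0 ?sqr_ge0 //; lra.
  - by lra.
  apply: (@le_trans _ _ ((M * (1 - eps)) * (M * (1 - 2 * eps)))).
    have : 0 <= 2 * (M * eps) ^+ 2 by rewrite mulr_ge0 ?sqr_ge0.
    by lra.
  by apply: ler_pM; [rewrite mulr_ge0|rewrite mulr_ge0| |]; lra.
have := le_trans lower main.
rewrite [X in _ <= X]mulrCA ler_pM2l ?exprn_gt0 // => fin.
have e3 : 3 * eps * (rho * n%:R) = 3 * (rho / eta).
  by rewrite /eps; field; rewrite !gt_eqF //; nra.
have h1 : rho * n%:R - l2 - 3 * (rho / eta) <= L * Z.
  apply: le_trans fin.
  have : 0 <= eps * l2 by rewrite mulr_ge0 ?ltW.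
  by lra.
have LZ : L * Z = L * k * n%:R - t%:R * (L * (m * k - 2)).
  by rewrite /Z natrM; ring.
have h2 : (sig * n%:R - 1) * (L * (m * k - 2)) <= t%:R * (L * (m * k - 2)).
  rewrite ler_wpM2r //; first by apply: mulr_ge0; lra.
  by move: t2; rewrite -natr1; lra.
have h3 : (L * k - sig * (L * (m * k - 2))) * n%:R <= (rho - delta) * n%:R.
  by rewrite ler_wpM2r // /rho /sig; lra.
by rewrite /K0 in nd; lra.
Qed.

(** * Passage to the rate *)

Lemma limn_esup_le_eventually (R : realType) (u : nat -> \bar R) (l : \bar R)
    (n0 : nat) :
  (forall n, (n0 <= n)%N -> (u n <= l)%E) -> (limn_esup u <= l)%E.
Proof.
move=> H; rewrite /limn_esup limf_esupE.
apply: (@le_trans _ _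
  (ereal_sup [set u n | n in [set n | (n0 <= n)%N]]))%classic.
  apply: ereal_inf_lbound; exists [set n | (n0 <= n)%N]%classic => //.
  by exists n0.
by apply: ge_ereal_sup => _ [n /= n0n <-]; apply: H.
Qed.

Theorem mainTheorem16 (R : realType) (b : nat) (hb : (4 < b)%N) :
  (hash_rate (R := R) b 4 <
   ((1 / log2 (b%:R : R)
     + (b%:R ^+ 2) / ((b%:R ^+ 2 - 3 * b%:R + 2) * log2 ((b - 2)%:R : R)))^-1)%:E)%E.
Proof.
set k : R := (b%:R ^+ 2 - 3 * b%:R + 2) / b%:R ^+ 2.
set B : R := ln b%:R; set L : R := ln (b - 2)%:R; set l2 : R := ln 2.
have bR : 5 <= b%:R :> R by rewrite ler_nat.
have b2R : (b - 2)%:R = b%:R - 2 :> R by rewrite natrB //; lia.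
have l20 : 0 < l2 by rewrite ln_gt0 // ltr1n.
have B0 : 0 < B by rewrite ln_gt0 //; lra.
have L0 : 0 < L by rewrite ln_gt0 // b2R; lra.
have q0 : 0 < b%:R ^+ 2 - 3 * b%:R + 2 :> R by nra.
have b20 : 0 < b%:R ^+ 2 :> R by rewrite exprn_gt0 //; lra.
have k0 : 0 < k by rewrite divr_gt0.
have BkL : 0 < B + k * L by rewrite addr_gt0 // mulr_gt0.
(* The claimed bound in natural logarithms; dividing by [l2] returns to base 2. *)
pose T := k * L * B / (B + k * L).
have -> : (1 / log2 (b%:R : R) + (b%:R ^+ 2) /
   ((b%:R ^+ 2 - 3 * b%:R + 2) * log2 ((b - 2)%:R : R)))^-1 = T / l2.
  have -> : (b%:R ^+ 2) / ((b%:R ^+ 2 - 3 * b%:R + 2) *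
      log2 ((b - 2)%:R : R)) = 1 / (k * log2 ((b - 2)%:R : R)).
    rewrite /log2 -/L -/l2 /k; field.
    by rewrite !gt_eqF //; lra.
  rewrite /log2 -/B -/L -/l2 /T; field.
  have -> : l2 * (k * L) + l2 * B = l2 * (B + k * L) by ring.
  rewrite (lt0r_neq0 (mulr_gt0 l20 BkL)) (lt0r_neq0 l20) (lt0r_neq0 BkL).
  by rewrite (lt0r_neq0 L0) (lt0r_neq0 k0) (lt0r_neq0 B0).
have TE : T * (B + k * L) = k * L * B by rewrite /T divfK // gt_eqF.
have [rho [n0 [rhoT Hrho]]] := hash_code_exp_bound R b T hb TE.
(* A fixed [rho < T] valid for all large [n] keeps the inequality strict in the limit. The cut-off
   at 0 covers the case [#|C| = 0], where [ln 0 = 0]. *)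
apply: (@le_lt_trans _ _ (Num.max rho 0 / l2)%:E); last first.
  rewrite lte_fin ltr_pM2r ?invr_gt0 // gt_max rhoT /=.
  apply: divr_gt0 => //; apply: mulr_gt0 => //; exact: mulr_gt0.
(* The successor makes [n] positive, so that the factor [n^-1] can be cleared. *)
apply: (limn_esup_le_eventually _ _ _ n0.+1) => n nn0.
rewrite lee_fin /log2 -/l2 mulrA ler_pM2r ?invr_gt0 //.
have n1 : 0 < n%:R :> R by rewrite ltr0n; lia.
rewrite ler_pdivrMl //.
have rho0 : 0 <= Num.max rho 0 by rewrite le_max lexx orbT.
have [C hC ->] : exists2 C : {set word b n},
    is_hash_code 4 C & hashA b 4 n = #|C|.
  have : (0 < #|[pred C : {set word b n} | `[< is_hash_code 4 C >]]|)%N.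
    apply/card_gt0P; exists finset.set0; apply: asboolT => S.
    by rewrite finset.subset0 => /eqP ->; rewrite cards0.
  move=> /(eq_bigmax_cond (fun C : {set word b n} => #|C|)) [C hC e].
  by exists C => //; apply: asboolW.
have [c0|c0] := posnP #|C|.
  by rewrite c0 ln0 // mulr_ge0.
rewrite -ler_expR lnK ?posrE ?ltr0n //.
apply: le_trans (Hrho n C (ltnW nn0) hC) _.
by rewrite ler_expR mulrC ler_wpM2l // le_max lexx.
Qed.
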